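(* Let $(R,\mathfrak{m})$ be a Noetherian local ring and $\varphi$ an integral local self-map of $R$. Let $n$ be large enough that the self-map $\overline\varphi_n$ induced by $\varphi$ on $R/\ker\varphi^n$ is injective, and let $p\ge1$ be the smallest integer such that $({}^a\overline\varphi_n)^p$ is the identity on $\operatorname{Min}(R/\ker\varphi^n)$. If $\mathfrak{p}_i\in\operatorname{Spec}(R)$ is such that $\mathfrak{p}_i/\ker\varphi^n\in\operatorname{Min}(R/\ker\varphi^n)$, then $\varphi^p(\mathfrak{p}_i)R\subseteq\mathfrak{p}_i$; denoting by $\overline\varphi_{\mathfrak{p}_i}$ the self-map induced by $\varphi^p$ on $R/\mathfrak{p}_i$, $$h_{\mathrm{alg}}(\varphi,R)=\frac1p\max\{h_{\mathrm{alg}}(\overline\varphi_{\mathfrak{p}_i},R/\mathfrak{p}_i)\mid \mathfrak{p}_i/\ker\varphi^n\in\operatorname{Min}(R/\ker\varphi^n)\}.$$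
   Context: $\varphi$ integral means $R$ is integral over $\varphi(R)$; such a local self-map is of finite length. Since $\varphi(\ker\varphi^n)\subseteq\ker\varphi^n$, $\varphi$ induces a self-map $\overline\varphi_n$ of $R/\ker\varphi^n$, injective for $n$ large; it is integral, and ${}^a\overline\varphi_n$ ($\mathfrak{p}\mapsto\overline\varphi_n^{-1}(\mathfrak{p})$) permutes $\operatorname{Min}(R/\ker\varphi^n)$, the set of minimal primes. A self-map of finite length of a Noetherian local ring $(A,\mathfrak{n})$ is a ring endomorphism $\psi$ with $\psi(\mathfrak{n})\subseteq\mathfrak{n}$ and $\psi(\mathfrak{n})A$ $\mathfrak{n}$-primary. Put $\lambda(\psi^n):=\ell_A(A/\psi^n(\mathfrak{n})A)$; the algebraic entropy is $h_{\mathrm{alg}}(\psi,A):=\lim_{n\to\infty}\frac1n\log\lambda(\psi^n)$ (the limit exists). *)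

(* Defs.v *)
From Stdlib Require Import Reals.
From HB Require Import structures.
From mathcomp Require Import all_boot all_order all_algebra.

Set Implicit Arguments.
Unset Strict Implicit.
Unset Printing Implicit Defensive.

Import GRing.Theory.
Local Open Scope ring_scope.

Section CommAlg.
Variable A : comUnitRingType.

Definition is_ideal (I : A -> Prop) : Prop :=
  I 0 /\ (forall x y, I x -> I y -> I (x - y)) /\ (forall a x, I x -> I (a * x)).

Definition gen_ideal (S : A -> Prop) : A -> Prop :=
  fun x => forall J, is_ideal J -> (forall s, S s -> J s) -> J x.

Definition is_prime (P : A -> Prop) : Prop :=
  is_ideal P /\ ~ P 1 /\ (forall x y, P (x * y) -> P x \/ P y).

Definition maxideal : A -> Prop := fun x => x \notin GRing.unit.

Definition local_ring : Prop := is_ideal maxideal.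

Definition noetherian : Prop :=
  forall I, is_ideal I -> exists s : seq A, forall x, I x <-> gen_ideal (fun y => y \in s) x.

(* a strict chain J = I_0 < I_1 < ... < I_k = A of ideals, i.e. a chain
   0 = M_0 < ... < M_k = A/J of A-submodules of A/J, of length k *)
Definition chain_of_length (J : A -> Prop) (k : nat) : Prop :=
  exists I : nat -> A -> Prop,
    (forall i, (i <= k)%N -> is_ideal (I i)) /\
    (forall x, I 0%N x <-> J x) /\
    (forall x, I k x) /\
    (forall i, (i < k)%N ->
       (forall x, I i x -> I i.+1 x) /\ exists x, I i.+1 x /\ ~ I i x).

(* ell_A(A/J) = l (finite) *)
Definition has_length (J : A -> Prop) (l : nat) : Prop :=
  chain_of_length J l /\ forall k, chain_of_length J k -> (k <= l)%N.

Definition image_max_ideal (psi : A -> A) (n : nat) : A -> Prop :=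
  gen_ideal (fun y => exists x, maxideal x /\ y = iter n psi x).

Definition alg_entropy (psi : A -> A) (h : R) : Prop :=
  exists lam : nat -> nat,
    (forall k, has_length (image_max_ideal psi k.+1) (lam k)) /\
    Un_cv (fun k => Rdiv (ln (INR (lam k))) (INR k.+1)) h.

End CommAlg.

Section SelfMap.
Variable A : comUnitRingType.
Variable phi : {rmorphism A -> A}.

Definition local_selfmap : Prop :=
  forall x, maxideal x -> maxideal (phi x).

Definition integral_selfmap : Prop :=
  forall x : A, exists q : {poly A}, q \is monic /\ root (map_poly phi q) x.

Definition ker_iter (n : nat) : A -> Prop := fun x => iter n phi x = 0.

Definition min_prime_over (K : A -> Prop) (P : A -> Prop) : Prop :=
  is_prime P /\ (forall x, K x -> P x) /\
  forall Q, is_prime Q -> (forall x, K x -> Q x) -> (forall x, Q x -> P x) ->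
    forall x, P x -> Q x.

(* ({}^a bar phi_n)^q is the identity on Min(A/ker phi^n):
   (phi^q)^{-1}(P) = P for every such P *)
Definition spec_iter_id (n q : nat) : Prop :=
  forall P, min_prime_over (ker_iter n) P -> forall x, P (iter q phi x) <-> P x.

End SelfMap.

(* Main.v *)
Require Import Defs.
From Stdlib Require Import Reals Lra Classical ClassicalEpsilon.
From HB Require Import structures.
From mathcomp Require Import all_boot all_order all_algebra.
Import GRing.Theory.
Local Open Scope ring_scope.

Set Implicit Arguments.
Unset Strict Implicit.
Unset Printing Implicit Defensive.

(** Length is controlled by filtrations with steps that are zero or copies of the
   residue field: such a filtration of [A/J] base changes along a ring morphism
   [f] to a filtration of [A/f(J)A] with steps [A/f(m)A].  This one fact gives
   finiteness of all lengths (given that of [A/phi(m)A], which follows from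
   integrality), their submultiplicativity, hence the limits by Fekete's lemma,
   and the passage from [R/ker phi^n] back to [R].  Noetherian induction then
   yields finitely many minimal primes [P] over [ker phi^n] and a constant [C]
   with [l(R/J) <= C max_P l(R/(P + J))] for all [J] containing [ker phi^n]; so
   the entropy of [phi^p] is attained on some [R/P]. *)

(** * Elementary ideal operations: sums with a principal ideal and colon ideals *)

Section Ideals.
Variable A : comUnitRingType.
Implicit Types (I J K L P : A -> Prop) (x y z a : A).

(** This is the ideal [I + (x)]. *)
Definition addx I x : A -> Prop := fun y => exists a, I (y - a * x).

Lemma ideal0 I : is_ideal I -> I 0. Proof. by case. Qed.

Lemma idealB I x y : is_ideal I -> I x -> I y -> I (x - y).
Proof. by case=> _ [h _]; apply: h. Qed.

Lemma idealM I a x : is_ideal I -> I x -> I (a * x).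
Proof. by case=> _ [_ h]; apply: h. Qed.

Lemma idealMr I a x : is_ideal I -> I x -> I (x * a).
Proof. by move=> hI hx; rewrite mulrC; apply: idealM. Qed.

Lemma idealD I x y : is_ideal I -> I x -> I y -> I (x + y).
Proof.
move=> hI hx hy; rewrite -[y]opprK; apply: idealB => //.
by rewrite -[- y]add0r; apply: idealB => //; apply: ideal0.
Qed.

Lemma idealDr I x y : is_ideal I -> I x -> I (x + y) -> I y.
Proof. by move=> hI hx hxy; rewrite -[y](addKr x) addrC; apply: idealB. Qed.

Lemma ideal_addx I x : is_ideal I -> is_ideal (addx I x).
Proof.
move=> hI; split; first by exists 0; rewrite mul0r subrr; apply: ideal0.
split=> [y z [a ha] [b hb]|b y [a ha]].
  by exists (a - b); rewrite mulrBl opprD addrACA -opprD; apply: idealB.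
by exists (b * a); rewrite -mulrA -mulrBr; apply: idealM.
Qed.

Lemma sub_addx I x y : I y -> addx I x y.
Proof. by move=> h; exists 0; rewrite mul0r subr0. Qed.

Lemma mem_addx I x : is_ideal I -> addx I x x.
Proof. by move=> h; exists 1; rewrite mul1r subrr; apply: ideal0. Qed.

Lemma addx_min I J x : is_ideal J -> (forall y, I y -> J y) -> J x ->
  forall y, addx I x y -> J y.
Proof.
move=> hJ hIJ hx y [a /hIJ ha]; rewrite -[y](subrK (a * x)).
by apply: idealD => //; apply: idealM.
Qed.

Lemma ideal_gen (S : A -> Prop) : is_ideal (gen_ideal S).
Proof.
split; first by move=> J hJ _; apply: ideal0.
split=> [x y hx hy J hJ hS|a x hx J hJ hS].
  by apply: idealB => //; [apply: hx | apply: hy].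
by apply: idealM => //; apply: hx.
Qed.

Lemma gen_mem (S : A -> Prop) x : S x -> gen_ideal S x.
Proof. by move=> hx J _ /(_ _ hx). Qed.

Definition colon I x : A -> Prop := fun y => I (y * x).

Lemma ideal_colon I x : is_ideal I -> is_ideal (colon I x).
Proof.
move=> hI; rewrite /colon; split; first by rewrite mul0r; apply: ideal0.
split=> [y z hy hz|a y hy]; first by rewrite mulrBl; apply: idealB.
by rewrite -mulrA; apply: idealM.
Qed.

End Ideals.

Lemma ideal_preim (A B : comUnitRingType) (f : {rmorphism A -> B}) (I : B -> Prop) :
  is_ideal I -> is_ideal (fun x => I (f x)).
Proof.
move=> hI; split; first by rewrite rmorph0; apply: ideal0.
split=> [x y hx hy|a x hx]; first by rewrite rmorphB; apply: idealB.
by rewrite rmorphM; apply: idealM.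
Qed.

(** * Filtrations and lengths *)

Section Filtrations.
Variable A : comUnitRingType.
Implicit Types (I J K L P : A -> Prop) (x y z a : A).

Lemma prime_maxideal : local_ring A -> is_prime (@maxideal A).
Proof.
move=> loc; split=> //; split; first by rewrite /maxideal unitr1.
by move=> x y; rewrite /maxideal unitrM negb_and => /orP.
Qed.

Lemma ideal_sub_max I : is_ideal I -> ~ I 1 -> forall x, I x -> maxideal x.
Proof.
move=> hI h1 x hx; apply/negP => ux; apply: h1.
by rewrite -(mulVr ux); apply: idealM.
Qed.

Definition top : A -> Prop := fun=> True.

(* A chain of [l] cyclic steps from [I] up to an ideal containing [I'], every
   step being zero or isomorphic to the residue field: for local [A] the least
   possible [l] is the length of [(I + I')/I]. *)
Fixpoint filt I I' (l : nat) : Prop :=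
  if l is l'.+1 then
    exists x, (forall a, maxideal a -> I (a * x)) /\ filt (addx I x) I' l'
  else forall x, I' x -> I x.

Lemma addx_mono I J x : (forall y, I y -> J y) -> forall y, addx I x y -> addx J x y.
Proof. by move=> h y [a /h ha]; exists a. Qed.

Lemma filt_mono I J I' l : (forall x, I x -> J x) -> filt I I' l -> filt J I' l.
Proof.
elim: l I J => [|l IH] I J hIJ /=; first by move=> h x /h /hIJ.
case=> x [hm hf]; exists x; split; first by move=> a /hm /hIJ.
exact: IH (addx_mono (x := x) hIJ) hf.
Qed.

Lemma filt_anti I I' J' l : (forall x, J' x -> I' x) -> filt I I' l -> filt I J' l.
Proof.
move=> hJ; elim: l I => [|l IH] I /=; first by move=> h x /hJ /h.
by case=> x [hm /IH hf]; exists x.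
Qed.

Lemma filt_trans I J K (a b : nat) : filt I J a -> filt J K b -> filt I K (a + b).
Proof.
elim: a I => [|a IH] I /=; first exact: filt_mono.
by case=> x [hm hf] hJ; exists x; split=> //; apply: IH.
Qed.

Lemma filt_le I I' l l' : is_ideal I -> (l <= l')%N -> filt I I' l -> filt I I' l'.
Proof.
move=> hI /subnK <- hf; apply: (@filt_trans _ I) hf.
elim: (l' - l)%N => [|d IH] //=; exists 0; split.
  by move=> a _; rewrite mulr0; apply: ideal0.
by apply: filt_mono IH => x; apply: sub_addx.
Qed.

(** Modulo [I], multiplication by [x] kills [L] and maps [A] onto [(I + (x))/I]; a step generator
    [y] becomes the step generator [y * x]. *)
Lemma filt_cyclic L I x l : is_ideal I -> (forall y, L y -> I (y * x)) ->
  filt L top l -> filt I (addx I x) l.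
Proof.
elim: l L I => [|l IH] L I hI hL /=.
  move=> h; apply: addx_min => //; rewrite -[x]mul1r; apply: hL; exact: h.
case=> y [hm hf]; exists (y * x); split.
  by move=> a /hm /hL; rewrite mulrA.
apply: (@filt_anti _ (addx (addx I (y * x)) x)).
  by apply: addx_mono => z; apply: sub_addx.
apply: IH hf; first exact: ideal_addx.
by move=> z [a ha]; exists a; rewrite mulrA -mulrBl; apply: hL.
Qed.

Lemma filt_strict I J y l : is_ideal I -> is_ideal J -> (forall x, I x -> J x) ->
  J y -> ~ I y -> filt I top l -> exists2 l', (l' < l)%N & filt J top l'.
Proof.
elim: l I J => [|l IH] I J hI hJ hIJ Jy nIy /=; first by move=> h; case: nIy; apply: h.
case=> x [hm hf]; have [Jx|nJx] := classic (J x).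
  by exists l => //; apply: filt_mono hf; apply: addx_min.
have [|||||l' ll' hl'] := IH (addx I x) (addx J x) _ _ _ _ _ hf.
- exact: ideal_addx.
- exact: ideal_addx.
- exact: addx_mono.
- exact: sub_addx.
(* If [y] were [a * x] modulo [I], a unit [a] would put [x] in [J], and a nonunit [a] would put [y]
   in [I]. So [y] still separates the two enlarged ideals. *)
- case=> a Ia; have [ua|na] := boolP (a \in GRing.unit).
    case: nJx; rewrite -[x](mulKr ua); apply: idealM => //.
    by have := idealB hJ Jy (hIJ _ Ia); rewrite subKr.
  by case: nIy; rewrite -[y](subrK (a * x)); apply: idealD => //; apply: hm.
by exists l'.+1 => //=; exists x; split=> // a /hm /hIJ.
Qed.

(** By [filt_strict], each strict inclusion of the chain lowers the available filtration length by
    at least one. *)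
Lemma filt_chain J l k : is_ideal J -> filt J top l -> chain_of_length J k -> (k <= l)%N.
Proof.
move=> hJ hl [I [hI [I0 [Ik hs]]]].
have H i : (i <= k)%N -> exists2 l', (l' + i <= l)%N & filt (I i) top l'.
  elim: i => [|i IH] ik.
    by exists l; [rewrite addn0 | apply: filt_mono hl => x /I0].
  have [l' ll' hl'] := IH (ltnW ik); have [hsub [y [y1 y0]]] := hs _ ik.
  have [l2 h2 hf] := filt_strict (hI _ (ltnW ik)) (hI _ ik) hsub y1 y0 hl'.
  by exists l2 => //; apply: leq_trans ll'; rewrite addnS -addSn leq_add2r.
by have [l' h _] := H k (leqnn k); apply: leq_trans h; apply: leq_addl.
Qed.

(** For an ideal this minimum is the composition length: [filt_chain] shows that no chain is longer,
    and [islen_chain] builds a chain of this length. *)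
Definition islen I l := filt I top l /\ forall l', filt I top l' -> (l <= l')%N.

Lemma islen_exists I l : filt I top l -> exists l', islen I l'.
Proof.
elim/ltn_ind: l => l IH hl.
have [h|h] := classic (forall l', filt I top l' -> (l <= l')%N); first by exists l.
have [l' hn] := not_all_ex_not _ _ h.
have [hl' /negP] := imply_to_and _ _ hn.
by rewrite -ltnNge => /IH; apply.
Qed.

(** Minimality forces the first generator [x] out of [J] and makes [l] minimal for [J + (x)]; [J] is
    then put in front of the chain obtained by induction. *)
Lemma islen_chain J l : is_ideal J -> islen J l -> chain_of_length J l.
Proof.
elim: l J => [|l IH] J hJ [hl hmin].
  by exists (fun=> J); split=> //; split=> //; split=> // x; apply: hl.
have [x [hm hf]] := hl.
have nx : ~ J x.
  move=> Jx; have : filt J top l by apply: filt_mono hf; apply: addx_min.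
  by move/hmin; rewrite ltnn.
have hlen : islen (addx J x) l.
  split=> // l' hl'; rewrite -ltnS; apply: hmin; by exists x.
have hJx := ideal_addx x hJ.
have [I [hI [I0 [Ik hs]]]] := IH _ hJx hlen.
exists (fun i => if i is i'.+1 then I i' else J); split; first by case.
split=> //; split=> // -[_|i] ; last exact: hs.
split; first by move=> y Jy; apply/I0; apply: sub_addx.
by exists x; split=> //; apply/I0; apply: mem_addx.
Qed.

Lemma islen_has_length J l : is_ideal J -> islen J l -> has_length J l.
Proof.
move=> hJ hl; split; first exact: islen_chain.
by move=> k; apply: filt_chain => //; case: hl.
Qed.

(** Choice makes the length a total function; its value is meaningful only when [A/I] has some
    finite filtration. *)
Definition flen I : nat := epsilon (inhabits 0%N) (islen I).

Lemma flenP I l : filt I top l -> islen I (flen I).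
Proof. by move/islen_exists; apply: epsilon_spec. Qed.

Lemma flen_le I l : filt I top l -> (flen I <= l)%N.
Proof. by move=> h; have [_] := flenP h; apply. Qed.

Lemma flen_filt I l : filt I top l -> filt I top (flen I).
Proof. by case/flenP. Qed.

Lemma flen_gt0 I l : filt I top l -> ~ I 1 -> (0 < flen I)%N.
Proof. by move/flen_filt; case: (flen I) => // h []; apply: h. Qed.

(* The ideal [P + f(m)A], which computes [A/P] modulo the image of its maximal ideal. *)
Definition img_ideal P (f : A -> A) : A -> Prop :=
  gen_ideal (fun y => P y \/ exists x, maxideal x /\ y = f x).

(** A step generator [x] of [A/J] is killed by the maximal ideal, so [f x] is killed modulo [K] by
    [P] and by the image of the maximal ideal; by [filt_cyclic] the step costs at most [b]. *)
Lemma filt_base_change (f : {rmorphism A -> A}) P J K (a b : nat) :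
  is_ideal K -> (forall x, P x -> K x) -> (forall x, J x -> K (f x)) ->
  filt J top a -> filt (img_ideal P f) top b -> filt K top (a * b).
Proof.
move=> + + + + hb; elim: a J K => [|a IH] J K hK hPK hJK /=.
  move=> h x _; rewrite -[x]mulr1; apply: idealM => //.
  by rewrite -(rmorph1 f); apply: hJK; apply: h.
case=> x [hm hf]; rewrite mulSn.
apply: (@filt_trans _ (addx K (f x))).
  apply: filt_cyclic hb => // y /(_ (colon K (f x)) (ideal_colon (f x) hK)); apply.
  move=> z [/hPK hz|[t [ht ->]]]; rewrite /colon; first exact: idealMr.
  by rewrite -rmorphM; apply: hJK; apply: hm.
apply: IH hf; first exact: ideal_addx.
  by move=> y /hPK; apply: sub_addx.
by move=> y [c hc]; exists (f c); rewrite -rmorphM -rmorphB; apply: hJK.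
Qed.

(** The ideals [J + (x ^+ i)] descend from [A] to [J], and each successive quotient is cyclic and
    killed by [J + (x)], hence costs at most [l]. *)
Lemma filt_nilpotent J x N l : is_ideal J -> J (x ^+ N) ->
  filt (addx J x) top l -> filt J top (N * l).
Proof.
move=> hJ hN hl.
have H i : filt (addx J (x ^+ i)) top (i * l).
  elim: i => [|i IH].
    move=> y _; exists y; rewrite expr0 mulr1 subrr; exact: ideal0.
  rewrite mulSn; have hI := ideal_addx (x ^+ i.+1) hJ.
  apply: (@filt_trans _ (addx (addx J (x ^+ i.+1)) (x ^+ i))).
    apply: filt_cyclic hl => // y [a ha]; exists a.
    by rewrite exprS mulrA -mulrBl; apply: idealMr.
  by apply: filt_mono IH; apply: addx_mono => y; apply: sub_addx.
by apply: filt_mono (H N); apply: addx_min.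
Qed.

(** The elements of [s] are adjoined to [J] one at a time, and [filt_nilpotent] pays for each of
    them. *)
Lemma filt_finite J (s : seq A) : local_ring A -> is_ideal J ->
  (forall x, x \in s -> exists N, J (x ^+ N)) ->
  (forall K, is_ideal K -> (forall x, J x -> K x) -> (forall x, x \in s -> K x) ->
     forall x, maxideal x -> K x) ->
  exists l, filt J top l.
Proof.
move=> loc; elim: s J => [|x s IH] J hJ hs hm.
  (* Here [J] contains the maximal ideal, so a single step with generator 1 reaches [A]. *)
  exists 1%N, 1; split; first by move=> a ha; rewrite mulr1; apply: hm.
  by move=> y _; exists y; rewrite mulr1 subrr; apply: ideal0.
have [|y ys|K hK hJK hsK|l hl] := IH (addx J x).
- exact: ideal_addx.
- have [|N hN] := hs y; first by rewrite inE ys orbT.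
  by exists N; apply: sub_addx.
- apply: hm => // [y Jy|y]; first by apply: hJK; apply: sub_addx.
  rewrite inE => /orP[/eqP->|]; last exact: hsK.
  by apply: hJK; apply: mem_addx.
have [|N hN] := hs x; first by rewrite inE eqxx.
by exists (N * l)%N; apply: filt_nilpotent hl.
Qed.

(** * Minimal primes in Noetherian rings *)

(** Choice would enlarge a counterexample forever; the union of the resulting strict chain is
    finitely generated, hence already reached at a finite stage. *)
Lemma noetherian_ind (Q : (A -> Prop) -> Prop) : noetherian A ->
  (forall I, is_ideal I ->
     (forall J, is_ideal J -> (forall x, I x -> J x) -> (exists x, J x /\ ~ I x) -> Q J) ->
     Q I) ->
  forall I, is_ideal I -> Q I.
Proof.
move=> noeth hind I0 hI0; apply: NNPP => nQ.
pose T := {I | is_ideal I /\ ~ Q I}.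
have hstep (t : T) : exists t' : T,
    (forall x, sval t x -> sval t' x) /\ exists x, sval t' x /\ ~ sval t x.
  case: t => I [hI nI] /=; apply: NNPP => nex; apply: nI; apply: hind => // J hJ hIJ hx.
  by apply: NNPP => nJ; apply: nex; exists (exist _ J (conj hJ nJ)).
pose step t := sval (constructive_indefinite_description _ (hstep t)).
have stepP t := svalP (constructive_indefinite_description _ (hstep t)).
pose c i := sval (iter i step (exist _ I0 (conj hI0 nQ))).
have cI i : is_ideal (c i) by rewrite /c; case: (iter _ _ _) => I [].
have cS i : forall x, c i x -> c i.+1 x by case: (stepP (iter i step (exist _ I0 (conj hI0 nQ)))).
have cle i j : (i <= j)%N -> forall x, c i x -> c j x.
  move=> /subnK <- x hx; elim: (j - i)%N => // d; exact: cS.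
pose U x := exists i, c i x.
have hU : is_ideal U.
  split; first by exists 0%N; apply: ideal0.
  split=> [x y [i hi] [j hj]|a x [i hi]]; last by exists i; apply: idealM.
  exists (maxn i j); apply: idealB => //; first exact: (cle i _ (leq_maxl _ _)).
  exact: (cle j _ (leq_maxr _ _)).
have [s hs] := noeth _ hU.
have [N hN] : exists N, forall x, x \in s -> c N x.
  have : forall x, x \in s -> U x by move=> x xs; apply/hs; apply: gen_mem.
  elim: {hs}s => [|x s IH] hx; first by exists 0%N.
  have [|N hN] := IH; first by move=> y ys; apply: hx; rewrite inE ys orbT.
  have [|i hi] := hx x; first by rewrite inE eqxx.
  exists (maxn i N) => y; rewrite inE => /orP[/eqP->|/hN].
    exact: (cle i _ (leq_maxl _ _)).
  exact: (cle N _ (leq_maxr _ _)).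
have [_ [x [x1 x0]]] := stepP (iter N step (exist _ I0 (conj hI0 nQ))).
by apply: x0; apply: ((hs x).1 _ (c N)) => //; exists N.+1.
Qed.

(* If [x y \in I] with [x, y \notin I], then [I + (x)] and [(I : x)] are larger
   ideals, and [A/J] is an extension of [A/(J + (x))] by [A/(J : x)] for every
   [J] containing [I]. *)
Lemma noetherian_primes I : noetherian A -> is_ideal I ->
  exists (qs : seq (A -> Prop)) (C : nat),
    [/\ forall q, List.In q qs -> is_prime q /\ (forall x, I x -> q x),
        forall P, is_prime P -> (forall x, I x -> P x) ->
          exists2 q, List.In q qs & forall x, q x -> P x
      & forall J l, is_ideal J -> (forall x, I x -> J x) ->
          (forall q J', List.In q qs -> is_ideal J' -> (forall x, q x -> J' x) ->
             (forall x, J x -> J' x) -> filt J' top l) ->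
          filt J top (C * l)].
Proof.
move=> noeth; move: I; apply: noetherian_ind => // I hI IH.
have [I1|nI1] := classic (I 1).
  exists [::], 0%N; split=> //.
    by move=> P [_ [nP _]] h; case: nP; apply: h.
  by move=> J l hJ hIJ _ x _; rewrite -[x]mulr1; apply: idealM => //; apply: hIJ.
have [pI|npI] := classic (is_prime I).
  exists [:: I], 1%N; split.
  - by move=> q [<-|[]].
  - by move=> P _ hP; exists I => //; left.
  - by move=> J l hJ hIJ h; rewrite mul1n; apply: (h I) => //; left.
have [x [y [Ixy [nx ny]]]] : exists x y, I (x * y) /\ ~ I x /\ ~ I y.
  apply: NNPP => nex; apply: npI; split=> //; split=> // x y Ixy.
  apply: NNPP => /not_or_and [nx ny]; by apply: nex; exists x, y.
have [||qs1 [C1 [h1 p1 f1]]] := IH (addx I x) (ideal_addx x hI).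
- by move=> z; apply: sub_addx.
- by exists x; split=> //; apply: mem_addx.
have [||qs2 [C2 [h2 p2 f2]]] := IH (colon I x) (ideal_colon x hI).
- by move=> z; apply: idealMr.
- by exists y; rewrite /colon mulrC.
exists (qs1 ++ qs2), (C2 + C1)%N; split.
- move=> q hin; case: (List.in_app_or _ _ _ hin) => [/h1|/h2] [hq hs];
    split=> // z Iz; apply: hs.
    exact: sub_addx.
  exact: idealMr.
(* A prime over [I] contains [I + (x)] if it contains [x]; otherwise primality makes it contain
   [(I : x)]. *)
- move=> P hP hIP; have [Px|nPx] := classic (P x).
    have [|q hq hs] := p1 P hP; first by apply: addx_min => //; case: hP.
    by exists q => //; apply: List.in_or_app; left.
  have [z /hIP|q hq hs] := p2 P hP; first by case: hP => _ [_ h] /h [].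
  by exists q => //; apply: List.in_or_app; right.
- move=> J l hJ hIJ h; rewrite mulnDl.
  apply: (@filt_trans _ (addx J x)).
    apply: (@filt_cyclic (colon J x)) => //; apply: f2.
    + exact: ideal_colon.
    + by move=> z; apply: hIJ.
    + move=> q J' hq hJ' hqJ hs; apply: (h q) => // [|z Jz].
        by apply: List.in_or_app; right.
      by apply: hs; apply: idealMr.
  apply: f1.
  + exact: ideal_addx.
  + exact: addx_mono.
  + move=> q J' hq hJ' hqJ hs; apply: (h q) => // [|z Jz].
      by apply: List.in_or_app; left.
    by apply: hs; apply: sub_addx.
Qed.

(** Whenever the head of the list lies strictly below the current candidate, the search restarts
    from that head. *)
Lemma minimal_below (qs : seq (A -> Prop)) P :
  exists q, [/\ q = P \/ List.In q qs, forall x, q x -> P x &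
    forall r, List.In r qs -> (forall x, r x -> q x) -> forall x, q x -> r x].
Proof.
elim: qs P => [|r qs IH] P; first by exists P; split=> //; left.
have [q [hq hqP hmin]] := IH P.
have [h|h] := classic ((forall x, r x -> q x) -> forall x, q x -> r x).
  exists q; split=> //; first by case: hq; [left | right; right].
  by move=> t [<-|/hmin].
have [hrq _] := imply_to_and _ _ h.
have [q' [hq' hq'r hmin']] := IH r.
exists q'; split.
- by case: hq' => [->|]; right; [left | right].
- by move=> x /hq'r /hrq /hqP.
- by move=> t [<-|/hmin'].
Qed.

(** Each prime of the previous list is replaced by a minimal list member below it. An ideal
    containing the old prime contains the new one, so the length bound survives. *)
Lemma noetherian_min_primes I : noetherian A -> is_ideal I ->
  exists (ps : seq (A -> Prop)) (C : nat),
    [/\ forall P, List.In P ps -> min_prime_over I P,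
        forall P, is_prime P -> (forall x, I x -> P x) -> exists q, List.In q ps
      & forall J l, is_ideal J -> (forall x, I x -> J x) ->
          (forall q J', List.In q ps -> is_ideal J' -> (forall x, q x -> J' x) ->
             (forall x, J x -> J' x) -> filt J' top l) ->
          filt J top (C * l)].
Proof.
move=> noeth hI; have [qs [C [hq hP hf]]] := noetherian_primes noeth hI.
pose m q := sval (constructive_indefinite_description _ (minimal_below qs q)).
have mP q : List.In q qs -> [/\ List.In (m q) qs, forall x, m q x -> q x &
    forall r, List.In r qs -> (forall x, r x -> m q x) -> forall x, m q x -> r x].
  move=> h; rewrite /m; case: constructive_indefinite_description => r /= [h1 h2 h3].
  by split=> //; case: h1 => [->|].
exists (map m qs), C; split.
- move=> _ /List.in_map_iff [q [<- /mP [h1 h2 h3]]].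
  have [pm Im] := hq _ h1; split=> //; split=> // Q pQ IQ Qm.
  have [r hr rQ] := hP Q pQ IQ.
  move=> x mx; apply: (rQ).
  by apply: (h3 r) => // y /rQ /Qm.
- move=> P pP IP; have [q hqs _] := hP P pP IP; exists (m q).
  exact: List.in_map.
- move=> J l hJ hIJ h; apply: hf => // q J' hqs hJ' hqJ hJJ.
  apply: (h (m q)) => //; first exact: List.in_map.
  by have [_ hm _] := mP q hqs; move=> x /hm /hqJ.
Qed.

End Filtrations.

(** * Subadditive sequences *)

Section Fekete.
Local Open Scope R_scope.

(** The limit is the infimum of the quotients, which is what the second clause records. *)
Lemma fekete (u : nat -> R) :
  (forall i, 0 <= u i) -> (forall i j, u (i + j)%N <= u i + u j) ->
  exists h, Un_cv (fun k => u k.+1 / INR k.+1) h /\ forall k, INR k * h <= u k.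
Proof.
move=> u0 usub.
have Spos k : 0 < INR k.+1 by apply: lt_0_INR; apply/ltP.
(* [completeness] yields suprema, so the quotients are negated and the infimum is [- s]. *)
pose E x := exists k, x = - (u k.+1 / INR k.+1).
have [||s [sub slub]] := completeness E.
- exists 0 => _ [k ->]; have := Rle_mult_inv_pos _ _ (u0 k.+1) (Spos k).
  by rewrite /Rdiv; lra.
- by exists (- (u 1%N / INR 1)), 0%N.
have hle k : INR k * - s <= u k.
  case: k => [|k]; first by rewrite Rmult_0_l.
  have hk : - (u k.+1 / INR k.+1) <= s by apply: sub; exists k.
  have -> : u k.+1 = INR k.+1 * (u k.+1 / INR k.+1).
    by field; apply: Rgt_not_eq; apply: Spos.
  by apply: Rmult_le_compat_l; [apply: Rlt_le | lra].
exists (- s); split=> // e e0.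
have [q hq] : exists q, u q.+1 / INR q.+1 < - s + e / 2.
  apply: NNPP => nex; have : s <= s - e / 2; last by lra.
  apply: slub => _ [k ->]; have := not_ex_all_not _ _ nex k; lra.
have umul a q' r : u (a * q' + r)%N <= INR a * u q' + u r.
  elim: a => [|a IH]; first by rewrite mul0n add0n Rmult_0_l; lra.
  by rewrite mulSn -addnA S_INR; have := usub q' (a * q' + r)%N; lra.
(* [B] dominates [u r] for every remainder [r] of a division by [q.+1]; [N] below is chosen so that
   [B] contributes less than [e / 2] after division by [k.+1]. *)
pose B := u 0%N + INR q.+1 * u 1%N.
have hB r : (r < q.+1)%N -> u r <= B.
  move=> rq; have := umul r 1%N 0%N; rewrite muln1 addn0 /B.
  have : INR r <= INR q.+1 by apply: le_INR; apply/leP; apply: ltnW.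
  move/(Rmult_le_compat_r (u 1%N) _ _ (u0 1%N)); lra.
have B0 : 0 <= B by apply: Rle_trans (u0 0%N) (hB _ _).
have [N hN] := INR_unbounded (B / (e / 2)).
exists N => k kN; rewrite /Rdist.
have kpos := Spos k.
have kB : B < INR k.+1 * (e / 2).
  have : INR N <= INR k.+1 by apply: le_INR; apply/leP; apply: leqW; apply/leP.
  move=> hNk; have e2 : 0 < e / 2 by lra.
  have -> : B = B / (e / 2) * (e / 2) by field; lra.
  by apply: Rmult_lt_compat_r => //; lra.
have -> : u k.+1 / INR k.+1 - - s = (u k.+1 - INR k.+1 * - s) / INR k.+1.
  by field; apply: Rgt_not_eq.
have hk := hle k.+1.
rewrite Rabs_pos_eq; last by apply: Rle_mult_inv_pos => //; lra.
apply: (Rmult_lt_reg_r (INR k.+1)) => //.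
rewrite /Rdiv Rmult_assoc Rinv_l ?Rmult_1_r; last by apply: Rgt_not_eq.
have := umul (k.+1 %/ q.+1)%N q.+1 (k.+1 %% q.+1)%N; rewrite -divn_eq.
have := hB (k.+1 %% q.+1)%N; rewrite ltn_mod => /(_ isT).
set a := (_ %/ _)%N.
have haq : INR a * INR q.+1 <= INR k.+1.
  by rewrite -mult_INR; apply: le_INR; apply/leP; rewrite multE leq_trunc_div.
have uq : u q.+1 = INR q.+1 * (u q.+1 / INR q.+1).
  by field; apply: Rgt_not_eq; apply: Spos.
have v0 : 0 <= u q.+1 / INR q.+1 by apply: Rle_mult_inv_pos.
move: hq v0 uq; set v := (u q.+1 / INR q.+1) => hq v0 -> h1 h2.
have : INR a * INR q.+1 * v <= INR k.+1 * v by apply: Rmult_le_compat_r.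
have : INR k.+1 * v < INR k.+1 * (- s + e / 2) by apply: Rmult_lt_compat_l.
lra.
Qed.

Lemma no_linear_bound (d c : R) N : 0 < d -> ~ forall k, (N <= k)%N -> INR k * d <= c.
Proof.
move=> d0 h; have [M hM] := INR_unbounded (c / d).
have := h (maxn N M) (leq_maxl _ _).
have : INR M <= INR (maxn N M) by apply: le_INR; apply/leP; apply: leq_maxr.
move=> hm; have : c / d * d < INR (maxn N M) * d by apply: Rmult_lt_compat_r; lra.
have -> : c / d * d = c by field; lra.
lra.
Qed.
Lemma le_ln_INR i j : (0 < i)%N -> (i <= j)%N -> ln (INR i) <= ln (INR j).
Proof.
move=> i0; rewrite leq_eqVlt => /orP[/eqP->|ij]; first exact: Rle_refl.
by apply: Rlt_le; apply: ln_increasing; [apply: lt_0_INR | apply: lt_INR]; apply/ltP.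
Qed.

End Fekete.

(** * Entropy of self-maps *)

Section IntegralSelfMap.
Variables (A : comUnitRingType) (phi : {rmorphism A -> A}).
Hypothesis loc : local_ring A.

(* Modulo an ideal containing [phi(m)], the polynomial [phi q] at [x \in m] is a
   power of [x] times a unit. *)
Lemma power_of_root (J : A -> Prop) (q : {poly A}) x :
  is_ideal J -> (forall a, maxideal a -> J (phi a)) -> maxideal x ->
  (exists i, q`_i \is a GRing.unit) ->
  exists N, forall y, J (y * (map_poly phi q).[x]) -> J (y * x ^+ N).
Proof.
move=> hJ hm hx; elim/poly_ind: q => [|q c IH] [i].
  by rewrite coef0 unitr0.
rewrite rmorphD rmorphM /= map_polyX map_polyC hornerD hornerMX hornerC /= => ui.
set r := _.[x] in IH *; have [uc|nc] := boolP (c \is a GRing.unit).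
  exists 0%N => y; rewrite expr0 mulr1.
  (* As [r * x] lies in the maximal ideal and [phi c] is a unit, the sum is a unit. *)
  have uw : r * x + phi c \is a GRing.unit.
    apply: contraT => nw; have : maxideal (phi c).
      by apply: (@idealDr _ _ (r * x)) => //; apply: idealM.
    by rewrite /maxideal rmorph_unit.
  by move=> Jy; rewrite -[y](mulrK uw); apply: idealMr.
case: i ui => [|i]; rewrite coefD coefMX coefC /= ?add0r ?addr0.
  by rewrite (negbTE nc).
(* Now [phi c] lies in [J] and drops out. The remaining factor [x] is absorbed into the multiplier
   [y], which is why the claim is stated for all [y]. *)
move=> ui; have [|N hN] := IH; first by exists i.
exists N.+1 => y; rewrite mulrDr => Jy; rewrite exprS mulrA; apply: hN.
rewrite -mulrA [x * r]mulrC; apply: (@idealDr _ _ (y * phi c)) => //.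
  by apply: idealM => //; apply: hm.
by rewrite addrC.
Qed.

(** A monic equation has a unit among its coefficients, so [power_of_root] makes every generator of
    the maximal ideal nilpotent modulo [img_ideal P phi]. *)
Lemma integral_finite P : noetherian A -> local_selfmap phi -> integral_selfmap phi ->
  exists l, filt (img_ideal P phi) (@top A) l.
Proof.
move=> noeth lphi int; have [s hs] := noeth _ loc.
have hJ : is_ideal (img_ideal P phi) by apply: ideal_gen.
apply: (@filt_finite _ _ s) => // [x xs|K hK _ hsK x /hs]; last by apply.
have [q [mq rq]] := int x.
have [||||N hN] := @power_of_root (img_ideal P phi) q x => //.
- by move=> a ha; apply: gen_mem; right; exists a.
- by apply/hs; apply: gen_mem.
- by exists (size q).-1; move/monicP: mq; rewrite /lead_coef => ->; rewrite unitr1.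
exists N; rewrite -[_ ^+ _]mul1r; apply: hN; rewrite mul1r (rootP rq).
exact: ideal0.
Qed.

End IntegralSelfMap.

(** Iterates are rebuilt with their ring morphism structure, so that base change applies to them. *)
Fixpoint rmiter (A : comUnitRingType) (f : {rmorphism A -> A}) n : {rmorphism A -> A} :=
  if n is n'.+1 then GRing.RMorphism.clone _ _ (f \o rmiter f n') _
  else GRing.RMorphism.clone _ _ idfun _.

Lemma rmiterE (A : comUnitRingType) (f : {rmorphism A -> A}) n x :
  rmiter f n x = iter n f x.
Proof. by elim: n => //= n ->. Qed.

(** * Lengths and entropy of a self-map modulo a stable ideal [P] *)

Section RelativeEntropy.
Variables (A : comUnitRingType) (P : A -> Prop) (f : {rmorphism A -> A}).
Hypotheses (loc : local_ring A) (hP : is_ideal P) (nP1 : ~ P 1).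
Hypotheses (fP : forall x, P x -> P (f x)) (lf : local_selfmap f).
Hypothesis ffin : exists b, filt (img_ideal P f) (@top A) b.

Let I k := img_ideal P (iter k f).

Lemma img_ideal_sub_max k x : I k x -> maxideal x.
Proof.
apply=> // y [/(ideal_sub_max hP nP1) //|[z [hz ->]]].
by elim: k => // k; apply: lf.
Qed.

Lemma img_ideal_comp j k x : I k x -> I (j + k) (iter j f x).
Proof.
have hI : is_ideal (I (j + k)) by apply: ideal_gen.
rewrite -rmiterE => /(_ _ (ideal_preim (rmiter f j) hI)); apply.
move=> y [Py|[z [hz ->]]]; rewrite rmiterE; apply: gen_mem.
  by left; elim: {hI} j => // j; apply: fP.
by right; exists z; rewrite iterD.
Qed.

(** Iterated base change along [f], starting from the residue field at [k = 0]. *)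
Lemma filt_iter k : exists l, filt (I k) (@top A) l.
Proof.
have [b hb] := ffin; elim: k => [|k [l hl]].
  exists 1%N, 1; split=> [a ha|y _].
    by rewrite mulr1; apply: gen_mem; right; exists a.
  by exists y; rewrite mulr1 subrr; apply: ideal0; apply: ideal_gen.
exists (l * b)%N; apply: filt_base_change hl hb.
- exact: ideal_gen.
- by move=> x Px; apply: gen_mem; left.
- by move=> x; apply: (@img_ideal_comp 1).
Qed.

(** This is the length of [A/P] modulo the ideal generated by the image of the maximal ideal under
    the [k]-th iterate. *)
Definition rlen k := flen (img_ideal P (iter k f)).

Lemma rlenP k : filt (I k) (@top A) (rlen k).
Proof. by have [l hl] := filt_iter k; apply: flen_filt hl. Qed.

Lemma rlen_le k l : filt (I k) (@top A) l -> (rlen k <= l)%N.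
Proof. exact: flen_le. Qed.

Lemma rlen_gt0 k : (0 < rlen k)%N.
Proof.
apply: flen_gt0 (rlenP k) _ => /img_ideal_sub_max.
by rewrite /maxideal unitr1.
Qed.

Lemma filt_rmiter j : filt (img_ideal P (rmiter f j)) (@top A) (rlen j).
Proof.
apply: filt_mono (rlenP j) => x /(_ _ (ideal_gen _)); apply.
move=> y h; apply: gen_mem; case: h => [|[z [hz ->]]]; [by left | right].
by exists z; rewrite rmiterE.
Qed.

(** Base change, along the [i]-th iterate, of the filtration that computes [rlen j]. *)
Lemma rlen_submul i j : (rlen (i + j) <= rlen i * rlen j)%N.
Proof.
apply: rlen_le; rewrite mulnC.
apply: filt_base_change (rlenP j) (filt_rmiter i).
- exact: ideal_gen.
- by move=> x Px; apply: gen_mem; left.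
- by move=> x; rewrite rmiterE; apply: img_ideal_comp.
Qed.

Lemma INR_rlen_gt0 k : Rlt 0 (INR (rlen k)).
Proof. by apply: lt_0_INR; apply/ltP; apply: rlen_gt0. Qed.

(** Fekete's lemma for the logarithms. Both clauses serve later, where the infimum bound for one map
    is played against the limit for another. *)
Lemma rel_entropy : exists h,
  Un_cv (fun k => Rdiv (ln (INR (rlen k.+1))) (INR k.+1)) h /\
  forall k, Rle (Rmult (INR k) h) (ln (INR (rlen k))).
Proof.
apply: fekete => [k|i j].
  by rewrite -ln_1 -INR_1; apply: le_ln_INR (rlen_gt0 k).
rewrite -ln_mult; [|exact: INR_rlen_gt0..].
by rewrite -mult_INR multE; apply: le_ln_INR (rlen_submul i j); apply: rlen_gt0.
Qed.

(** * Transfer to a ring [B] presenting [A/P] by a surjection with kernel [P] *)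

Section Presentation.
Variables (B : comUnitRingType) (pi : {rmorphism A -> B}) (psi : B -> B).
Hypotheses (surj : forall b : B, exists x, pi x = b).
Hypotheses (kerpi : forall x, pi x = 0 <-> P x).
Hypotheses (psipi : forall x, psi (pi x) = pi (f x)).

(** As [P] lies in the maximal ideal, an element invertible modulo [P] is already invertible. *)
Lemma maxideal_pi x : maxideal (pi x) <-> maxideal x.
Proof.
rewrite /maxideal; split; apply: contra; first exact: rmorph_unit.
case/unitrP => b [hb _]; have [y hy] := surj b.
have : P (y * x - 1) by apply/kerpi; rewrite rmorphB rmorphM rmorph1 hy hb subrr.
move/(ideal_sub_max hP nP1) => hm.
apply: contraT => nx; have : maxideal (- 1 : A).
  by apply: idealDr hm => //; apply: idealM.
by rewrite /maxideal unitrN1.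
Qed.

Lemma filt_pi (J : B -> Prop) l :
  filt (fun x => J (pi x)) (@top A) l <-> filt J (@top B) l.
Proof.
have addpi (K : B -> Prop) x y : addx K (pi x) (pi y) <-> addx (fun x => K (pi x)) x y.
  split=> [[b]|[a]].
    by have [a <-] := surj b; exists a; rewrite rmorphB rmorphM.
  by exists (pi a); rewrite -rmorphM -rmorphB.
elim: l J => [|l IH] J /=.
  split=> h x _; last exact: h.
  by have [y <-] := surj x; apply: h.
split=> [[x [hm hf]]|[b [hm hf]]].
  exists (pi x); split.
    move=> b; have [a <-] := surj b; rewrite maxideal_pi -rmorphM; exact: hm.
  by apply/IH; apply: filt_mono hf => y /addpi.
have [x hx] := surj b; rewrite -{}hx in hm hf; exists x; split.
  by move=> a ha; rewrite rmorphM; apply: hm; apply/maxideal_pi.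
by move/IH: hf; apply: filt_mono => y /addpi.
Qed.

Lemma iter_pi k x : iter k psi (pi x) = pi (iter k f x).
Proof. by elim: k => //= k ->; rewrite psipi. Qed.

Lemma image_max_ideal_pi k x : image_max_ideal psi k (pi x) <-> I k x.
Proof.
have hI : is_ideal (I k) by apply: ideal_gen.
have hM : is_ideal (image_max_ideal psi k) by apply: ideal_gen.
split.
  (* [J] is the image of [I k], an ideal by surjectivity. Two lifts of the same element differ by an
     element of [P], so membership in [J] pulls back to [I k]. *)
  pose J b := exists2 y, pi y = b & I k y.
  have hJ : is_ideal J.
    split; first by exists 0; [rewrite rmorph0 | exact: (ideal0 hI)].
    split=> [_ _ [y <- Iy] [z <- Iz]|b _ [y <- Iy]].
      by exists (y - z); [rewrite rmorphB | exact: (idealB hI Iy Iz)].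
    by have [a <-] := surj b; exists (a * y); [rewrite rmorphM | exact: (idealM a hI Iy)].
  move/(_ J hJ) => [_ [b [hb ->]]|y hy Iy].
    have [a ha] := surj b; rewrite -{}ha in hb *; rewrite iter_pi.
    by exists (iter k f a) => //; apply: gen_mem; right; exists a; split=> //; apply/maxideal_pi.
  rewrite -[x](subrK y); apply: (idealD hI) => //; apply: gen_mem; left.
  by apply/kerpi; rewrite rmorphB hy subrr.
move/(_ _ (ideal_preim pi hM)); apply.
move=> y [/kerpi ->|[z [hz ->]]]; first exact: ideal0.
by apply: gen_mem; exists (pi z); rewrite iter_pi maxideal_pi.
Qed.

Lemma alg_entropy_presentation h :
  Un_cv (fun k => Rdiv (ln (INR (rlen k.+1))) (INR k.+1)) h -> alg_entropy psi h.
Proof.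
exists (fun k => rlen k.+1); split=> // k.
apply: islen_has_length; first exact: ideal_gen.
split=> [|l]; rewrite -filt_pi.
  by apply: filt_mono (rlenP k.+1) => x /image_max_ideal_pi.
by move=> hl; apply: rlen_le; apply: filt_mono hl => x /image_max_ideal_pi.
Qed.

End Presentation.
End RelativeEntropy.

Lemma seq_argmax (T : Type) (g : T -> nat) (s : seq T) t : List.In t s ->
  exists2 m, List.In m s & forall r, List.In r s -> (g r <= g m)%N.
Proof.
elim: s t => // x s IH t _; case: s IH => [|y s] IH.
  by exists x; [left | move=> r [<-|[]]].
have [|m hm hmax] := IH y; first by left.
have [le|lt] := leqP (g m) (g x).
  by exists x; [left | move=> r [<- //|/hmax hr]; apply: leq_trans le].
by exists m; [right | move=> r [<-|/hmax //]; apply: ltnW].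
Qed.

Lemma ideal_zero (A : comUnitRingType) : is_ideal (fun x : A => x = 0).
Proof.
split=> //; split=> [x y -> ->|a x ->]; first by rewrite subrr.
by rewrite mulr0.
Qed.

Lemma ideal_ker_iter (A : comUnitRingType) (phi : {rmorphism A -> A}) n :
  is_ideal (ker_iter phi n).
Proof.
have := ideal_preim (rmiter phi n) (ideal_zero A).
move=> [h0 [hB hM]]; rewrite /ker_iter; split; first by rewrite -rmiterE.
by split=> [x y|a x]; rewrite -!rmiterE; [apply: hB | apply: hM].
Qed.

(** * Comparison of [phi] on [A] with its [p]-th iterate modulo the minimal primes *)

Section Comparison.
Variables (A : comUnitRingType) (phi : {rmorphism A -> A}) (n p : nat).
Hypotheses (noeth : noetherian A) (loc : local_ring A).
Hypotheses (lphi : local_selfmap phi) (int : integral_selfmap phi).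
Hypotheses (p0 : (0 < p)%N) (hspec : spec_iter_id phi n p).

(** With the zero ideal, [rlen Z phi] gives the absolute lengths that define the entropy of
    [phi]. *)
Let Z (x : A) := x = 0.
Let K := ker_iter phi n.
Let f := rmiter phi p.
Let fE x : f x = iter p phi x := rmiterE phi p x.

Let hZ : is_ideal Z := ideal_zero A.
Let nZ1 : ~ Z 1. Proof. by move/eqP; rewrite oner_eq0. Qed.
Let phiZ x : Z x -> Z (phi x). Proof. by move=> ->; rewrite /Z rmorph0. Qed.
Let finZ : exists b, filt (img_ideal Z phi) (@top A) b.
Proof. exact: integral_finite. Qed.

Lemma iter_img_ideal (P : A -> Prop) k : is_ideal P ->
  forall x, img_ideal Z (iter (k * p) phi) x -> img_ideal P (iter k f) x.
Proof.
move=> hP x; apply=> [|y]; first exact: ideal_gen.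
move=> [->|[z [hz ->]]]; first by apply: ideal0; apply: ideal_gen.
apply: gen_mem; right; exists z; split=> //.
by rewrite iterM; apply: eq_iter.
Qed.

(** The quotient in question is a quotient of [A] modulo the ideal generated by the image of the
    maximal ideal under the [p]-th iterate of [phi]. *)
Lemma rmiter_finite (P : A -> Prop) : is_ideal P ->
  exists b, filt (img_ideal P f) (@top A) b.
Proof.
move=> hP; have [b hb] := filt_iter phiZ finZ (1 * p).
by exists b; apply: filt_mono hb => x; apply: (@iter_img_ideal P 1).
Qed.

Lemma rmiter_local : local_selfmap f.
Proof. by move=> x hx; rewrite fE; elim: p => // k; apply: lphi. Qed.

Lemma rlen_prime_le (P : A -> Prop) k : is_ideal P -> (forall x, P x -> P (f x)) ->
  (rlen P f k <= rlen Z phi (k * p))%N.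
Proof.
move=> hP fP; apply: rlen_le.
by apply: filt_mono (rlenP phiZ finZ (k * p)) => x; apply: iter_img_ideal.
Qed.

Lemma min_prime_stable P : min_prime_over K P -> forall x, P x -> P (f x).
Proof. by move=> mP x; rewrite fE; have [_] := hspec mP x. Qed.

(** The [n]-th iterate of [phi] kills [K], so it sends [img_ideal K (iter k f)] into
    [img_ideal Z (iter (n + k * p) phi)]. Base change along it costs the factor [rlen Z phi n], and
    [hC] bounds the length modulo the source ideal. *)
Lemma rlen_ker_bound (ps : seq (A -> Prop)) C :
  (forall P, List.In P ps -> min_prime_over K P) ->
  (forall J l, is_ideal J -> (forall x, K x -> J x) ->
     (forall q J', List.In q ps -> is_ideal J' -> (forall x, q x -> J' x) ->
        (forall x, J x -> J' x) -> filt J' (@top A) l) ->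
     filt J (@top A) (C * l)) ->
  forall k l, (forall P, List.In P ps -> (rlen P f k <= l)%N) ->
  (rlen Z phi (n + k * p) <= C * l * rlen Z phi n)%N.
Proof.
move=> hps hC k l hl; apply: rlen_le.
have hJ : is_ideal (img_ideal K (iter k f)) by apply: ideal_gen.
apply: (@filt_base_change _ (rmiter phi n) Z (img_ideal K (iter k f))).
- exact: ideal_gen.
- by move=> x Zx; apply: gen_mem; left.
- have hI : is_ideal (img_ideal Z (iter (n + k * p) phi)) by apply: ideal_gen.
  move=> x /(_ _ (ideal_preim (rmiter phi n) hI)); apply.
  move=> y [Ky|[z [hz ->]]]; rewrite rmiterE.
    by rewrite (Ky : iter n phi y = 0); apply: (ideal0 hI).
  apply: gen_mem; right; exists z; split=> //.
  by rewrite iterD iterM; congr (iter n phi); apply: eq_iter.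
- apply: hC => // [x Kx|q J' hq hJ' hqJ hJJ]; first by apply: gen_mem; left.
  have mq := hps q hq; have [pq _] := mq; have [iq [nq1 _]] := pq.
  have hlen := rlenP (min_prime_stable mq) (rmiter_finite iq) k.
  apply: (@filt_mono _ (img_ideal q (iter k f))).
    move=> x; apply=> // y [/hqJ //|[z [hz ->]]].
    by apply: hJJ; apply: gen_mem; right; exists z.
  by apply: filt_le (hl q hq) hlen; apply: ideal_gen.
- exact: filt_rmiter.
Qed.

(** If [hP / p] exceeded [h], the infimum bound for [P] would contradict the limit for [phi] along
    multiples of [p]. *)
Lemma limit_le_scaled h hP (P : A -> Prop) : is_ideal P -> ~ P 1 ->
  (forall x, P x -> P (f x)) ->
  Un_cv (fun k => Rdiv (ln (INR (rlen Z phi k.+1))) (INR k.+1)) h ->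
  (forall k, Rle (Rmult (INR k) hP) (ln (INR (rlen P f k)))) ->
  Rle hP (Rmult (INR p) h).
Proof.
move=> iP nP1 fP cv hle; apply: Rnot_lt_le => lt.
have pp : Rlt 0 (INR p) by apply: lt_0_INR; apply/ltP.
have e0 : Rlt 0 (Rminus (Rdiv hP (INR p)) h).
  apply: (Rmult_lt_reg_l (INR p)) => //; rewrite Rmult_0_r.
  have -> : Rmult (INR p) (Rminus (Rdiv hP (INR p)) h) = Rminus hP (Rmult (INR p) h).
    by field; apply: Rgt_not_eq.
  lra.
have [N hN] := cv _ e0.
(* The sequence is shifted by one, so the length of index [N.+1 * p] is reached at the predecessor,
   which is still at least [N]. *)
have m0 : (0 < N.+1 * p)%N by rewrite muln_gt0 p0.
have := hN (N.+1 * p).-1; rewrite prednK // /Rdist => hd.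
have {hd} /Rabs_def2 [hd _] : Rlt (Rabs (Rminus (Rdiv (ln (INR (rlen Z phi (N.+1 * p))))
    (INR (N.+1 * p))) h)) (Rminus (Rdiv hP (INR p)) h).
  by apply: hd; apply/leP; rewrite -ltnS prednK // leq_pmulr.
have hk := hle N.+1.
have hr := le_ln_INR (rlen_gt0 loc iP nP1 fP rmiter_local (rmiter_finite iP) N.+1)
  (rlen_prime_le N.+1 iP fP).
set u := ln (INR (rlen Z phi _)) in hd hr.
have NN : Rlt 0 (INR N.+1) by apply: lt_0_INR; apply/ltP.
have : Rlt (Rdiv u (INR (N.+1 * p))) (Rdiv hP (INR p)) by lra.
rewrite -multE mult_INR => hlt.
have := Rmult_lt_compat_l _ _ _ (Rmult_lt_0_compat _ _ NN pp) hlt.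
have -> : Rmult (Rmult (INR N.+1) (INR p)) (Rdiv u (Rmult (INR N.+1) (INR p))) = u.
  by field; split; apply: Rgt_not_eq.
have -> : Rmult (Rmult (INR N.+1) (INR p)) (Rdiv hP (INR p)) = Rmult (INR N.+1) hP.
  by field; apply: Rgt_not_eq.
lra.
Qed.

(** Finiteness of the list turns the separate strict inequalities into one rate [h'] below [H] and
    one threshold [N]. *)
Lemma uniform_growth (ps : seq (A -> Prop)) H :
  (forall P, List.In P ps -> exists2 hP, Rlt hP H &
     Un_cv (fun k => Rdiv (ln (INR (rlen P f k.+1))) (INR k.+1)) hP) ->
  exists h' N, Rlt h' H /\ forall k P, (N <= k)%N -> List.In P ps ->
    Rle (ln (INR (rlen P f k.+1))) (Rmult (INR k.+1) h').
Proof.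
elim: ps => [|P ps IH] hps.
  by exists (Rminus H 1), 0%N; split=> //; lra.
have [|h1 [N1 [lt1 b1]]] := IH; first by move=> Q hQ; apply: hps; right.
have [|hP ltP cv] := hps P; first by left.
(* The midpoint leaves room both for the convergence to [hP] and for strictness below [H]. *)
pose h2 := Rdiv (Rplus hP H) 2.
have [|N2 hN2] := cv (Rminus h2 hP); first by rewrite /h2; lra.
exists (Rmax h1 h2), (maxn N1 N2); split.
  by apply: Rmax_lub_lt => //; rewrite /h2; lra.
move=> k Q; rewrite geq_max => /andP [k1 k2] hQ.
have Sk : Rlt 0 (INR k.+1) by apply: lt_0_INR; apply/ssrnat.ltP.
have [e|/(b1 _ _ k1) hb] : P = Q \/ List.In Q ps by [].
  rewrite -e; have /Rabs_def2 [hd _] := hN2 k (elimT leP k2).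
  set u := ln _ in hd *; have -> : u = Rmult (INR k.+1) (Rdiv u (INR k.+1)).
    by field; apply: Rgt_not_eq.
  apply: Rmult_le_compat_l; first exact: Rlt_le.
  apply: Rle_trans (Rmax_r _ _); lra.
apply: Rle_trans hb _; apply: Rmult_le_compat_l; first exact: Rlt_le.
exact: Rmax_l.
Qed.

(* The primes [P] over [K] bound [rlen Z phi (n + k p)] by a constant times the
   largest [rlen P f k], so the entropies on [A/P] cannot all be smaller than [p h]. *)
Lemma max_attained h :
  (forall k, Rle (Rmult (INR k) h) (ln (INR (rlen Z phi k)))) ->
  exists P, min_prime_over K P /\
    forall hP, Un_cv (fun k => Rdiv (ln (INR (rlen P f k.+1))) (INR k.+1)) hP ->
      Rle (Rmult (INR p) h) hP.
Proof.
move=> hle; have hK : is_ideal K by apply: ideal_ker_iter.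
have [ps [C [mps nonempty hC]]] := noetherian_min_primes noeth hK.
(* The maximal ideal is a prime over [K], so the list is nonempty and a largest length exists for
   each index. *)
have [q hq] : exists q, List.In q ps.
  apply: (nonempty _ (prime_maxideal loc)); apply: ideal_sub_max => //.
  by rewrite /K /ker_iter -rmiterE rmorph1; apply: nZ1.
apply: NNPP => nex.
have [|h' [N [lt hb]]] := @uniform_growth ps (Rmult (INR p) h).
  move=> P hP; apply: NNPP => nP; apply: nex; exists P; split; first exact: mps.
  move=> hP' cv; apply: Rnot_lt_le => l; apply: nP; by exists hP'.
pose r := rlen Z phi n.
have r0 : (0 < r)%N by apply: rlen_gt0.
(* [C.+1] replaces [C] so that the constant is positive and its logarithm splits off. *)
have c0 : (0 < C.+1 * r)%N by rewrite muln_gt0.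
(* Combining [(n + k p) h <= ln (rlen Z phi (n + k p))] with [rlen_ker_bound] and the growth rate
   [h'] bounds [k (p h - h')] by a constant, although [p h - h'] is positive. *)
apply: (@no_linear_bound (Rminus (Rmult (INR p) h) h')
  (Rminus (ln (INR (C.+1 * r))) (Rmult (INR n) h)) N.+1); first lra.
case=> // k kN.
have [P hP hmax] := seq_argmax (fun P => rlen P f k.+1) hq.
have mP := mps P hP; have [[iP [nP1 _]] _] := mP.
have l0 : (0 < rlen P f k.+1)%N.
  apply: rlen_gt0 => //; [exact: min_prime_stable | exact: rmiter_local | exact: rmiter_finite].
have hlen : (rlen Z phi (n + k.+1 * p) <= C.+1 * r * rlen P f k.+1)%N.
  apply: leq_trans (rlen_ker_bound mps hC hmax) _.
  by rewrite -mulnA [(rlen P f _ * _)%N]mulnC mulnA !leq_mul.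
have := le_ln_INR (rlen_gt0 loc hZ nZ1 phiZ lphi finZ _) hlen.
rewrite -multE mult_INR multE ln_mult; try by apply: lt_0_INR; apply/ltP.
have := hle (n + k.+1 * p)%N; rewrite -plusE plus_INR -multE mult_INR.
have := hb k P kN hP; nra.
Qed.

End Comparison.

Theorem mainTheorem17 (R : comUnitRingType) (phi : {rmorphism R -> R})
  (n p : nat) :
  noetherian R -> local_ring R ->
  local_selfmap phi -> integral_selfmap phi ->
  (* bar phi_n injective on R / ker phi^n *)
  (forall x : R, ker_iter phi n (phi x) -> ker_iter phi n x) ->
  (* p >= 1 is the least integer with ({}^a bar phi_n)^p = id on Min(R/ker phi^n) *)
  (0 < p)%N -> spec_iter_id phi n p ->
  (forall q, (0 < q)%N -> (q < p)%N -> ~ spec_iter_id phi n q) ->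
  (* phi^p(P) R subset P *)
  (forall P, min_prime_over (ker_iter phi n) P ->
     forall x, gen_ideal (fun y => exists z, P z /\ y = iter p phi z) x -> P x) /\
  (* h_alg(phi, R) = (1/p) max_P h_alg(bar phi_P, R/P), where (A, pi, psi) is any
     presentation of R/P with the self-map induced by phi^p *)
  exists h : Rdefinitions.R,
    alg_entropy phi h /\
    (forall P, min_prime_over (ker_iter phi n) P ->
       forall (A : comUnitRingType) (pi : {rmorphism R -> A}) (psi : A -> A),
         (forall a : A, exists x, pi x = a) ->
         (forall x, pi x = 0 <-> P x) ->
         (forall x, psi (pi x) = pi (iter p phi x)) ->
         exists hP, alg_entropy psi hP /\ Rle hP (Rmult (INR p) h)) /\
    (exists P, min_prime_over (ker_iter phi n) P /\
       forall (A : comUnitRingType) (pi : {rmorphism R -> A}) (psi : A -> A),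
         (forall a : A, exists x, pi x = a) ->
         (forall x, pi x = 0 <-> P x) ->
         (forall x, psi (pi x) = pi (iter p phi x)) ->
         alg_entropy psi (Rmult (INR p) h)).
Proof.
move=> noeth loc lphi int _ p0 hspec _.
have hZ := ideal_zero R.
have nZ1 : (1 : R) <> 0 by apply/eqP; rewrite oner_eq0.
have phiZ (x : R) : x = 0 -> phi x = 0 by move=> ->; rewrite rmorph0.
have finZ := integral_finite loc (fun x => x = 0) noeth lphi int.
have entP P : min_prime_over (ker_iter phi n) P -> exists hP,
    Un_cv (fun k => Rdiv (ln (INR (rlen P (rmiter phi p) k.+1))) (INR k.+1)) hP /\
    forall k, Rle (Rmult (INR k) hP) (ln (INR (rlen P (rmiter phi p) k))).
  move=> mP; have [[iP [nP1 _]] _] := mP; apply: rel_entropy => //.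
  - exact: min_prime_stable hspec _ mP.
  - exact: rmiter_local.
  - exact: rmiter_finite.
have presP P (A : comUnitRingType) (pi : {rmorphism R -> A}) (psi : A -> A) hP :
    min_prime_over (ker_iter phi n) P ->
    (forall a : A, exists x, pi x = a) -> (forall x, pi x = 0 <-> P x) ->
    (forall x, psi (pi x) = pi (iter p phi x)) ->
    Un_cv (fun k => Rdiv (ln (INR (rlen P (rmiter phi p) k.+1))) (INR k.+1)) hP ->
    alg_entropy psi hP.
  move=> mP surj kerpi psipi; have [[iP [nP1 _]] _] := mP.
  apply: (alg_entropy_presentation loc iP nP1 _ _ surj kerpi).
  - exact: min_prime_stable hspec _ mP.
  - exact: rmiter_finite.
  - by move=> x; rewrite rmiterE.
split.
  move=> P mP x; apply; first by case: mP => [[]].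
  by move=> _ [z [Pz ->]]; apply/(hspec P mP).
have [h [cv hle]] := rel_entropy loc hZ nZ1 phiZ lphi finZ.
have hup P hP : min_prime_over (ker_iter phi n) P ->
    (forall k, Rle (Rmult (INR k) hP) (ln (INR (rlen P (rmiter phi p) k)))) ->
    Rle hP (Rmult (INR p) h).
  move=> mP; have [[iP [nP1 _]] _] := mP.
  by apply: limit_le_scaled cv => //; apply: min_prime_stable hspec _ mP.
exists h; split.
  (* [R] presents its quotient by the zero ideal through the identity. *)
  apply: (@alg_entropy_presentation _ _ phi loc hZ nZ1 phiZ finZ R idfun) => //.
  by move=> b; exists b.
split=> [P mP A pi psi surj kerpi psipi|].
  have [hP [cvP hleP]] := entP P mP.
  by exists hP; split; [apply: presP cvP | apply: hup hleP].
have [P [mP hmax]] := max_attained noeth loc lphi int hspec hle.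
exists P; split=> // A pi psi surj kerpi psipi.
have [hP [cvP hleP]] := entP P mP.
(* The upper bound holds for every minimal prime, and the reverse one is the choice of [P]. *)
have <- : hP = Rmult (INR p) h.
  by apply: Rle_antisym; [apply: hup hleP | apply: hmax].
exact: presP cvP.
Qed.
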